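(* The centraliser of a periodic element in a cyclic Garside groupoid is a weak Garside group. That is: let $(\mathcal{C},\phi,\Delta)$ be a cyclic categorical Garside structure with Garside groupoid $\mathcal{G}$, let $x$ be an object and $\mathcal{G}_x$ the group of endomorphisms of $x$ in $\mathcal{G}$, and let $\gamma\in\mathcal{G}_x$ be periodic, i.e. $\gamma^q=\Delta^p$ for some $p\in\mathbb{Z}$, $q\in\mathbb{Z}_{\ge1}$. Then the centraliser of $\gamma$ in the weak Garside group $\mathcal{G}_x$ is a weak Garside group.
   Context: Conventions. Morphisms compose like paths: $x\xrightarrow{f}y\xrightarrow{g}z$ has composite $fg$. The image of an object or morphism under an automorphism $\phi$ is written $x^\phi$, $f^\phi$. In a category $\mathcal{C}$, $\mathcal{C}_{x\to}$ (resp. $\mathcal{C}_{\to x}$) is the set of morphisms with source (resp. target) $x$; $f\le g$ on $\mathcal{C}_{x\to}$ means $g=fh$ for some $h$; $g\ge h$ on $\mathcal{C}_{\to x}$ means $g=fh$ for some $f$. An atom is a non-identity morphism that is not a product of two non-identity morphisms. A categorical Garside structure is a triple $(\mathcal{C},\phi,\Delta)$ where $\mathcal{C}$ is a small category, $\phi$ is an automorphism of $\mathcal{C}$ and $\Delta$ is a natural transformation from the identity functor to $\phi$ (so $\Delta_x:x\to x^\phi$ and $f\Delta_y=\Delta_xf^\phi$ for $f:x\to y$), such that: $\mathcal{C}$ is homogeneous (there is a function $l$ from morphisms to $\mathbb{Z}_{\ge0}$ with $l(fg)=l(f)+l(g)$ and $l(f)=0$ iff $f$ is an identity); $\mathcal{C}$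 is cancellative ($afb=agb$ implies $f=g$); every atom is simple, where $f:x\to y$ is simple if there is $\overline f:y\to x^\phi$ with $f\overline f=\Delta_x$; for every object $x$, $(\mathcal{C}_{x\to},\le)$ and $(\mathcal{C}_{\to x},\ge)$ are lattices. It is cyclic if $\phi^k=1$ for some $k\ge1$. The Garside groupoid of the structure is the groupoid obtained from $\mathcal{C}$ by formally inverting all morphisms ($\mathcal{C}$ embeds in it, and $\phi,\Delta$ extend to it). A weak Garside group is a group isomorphic to the endomorphism group $\mathcal{G}_x$ of an object $x$ of some (not necessarily cyclic) Garside groupoid $\mathcal{G}$. For $p\ge0$, $\Delta^p$ with source $x$ denotes $\Delta_x\Delta_{x^\phi}\cdots\Delta_{x^{\phi^{p-1}}}$; for $p<0$ it denotes the inverse of the $\Delta^{-p}$ with target $x$. In $\gamma^q=\Delta^p$ both sides have source $x$. *)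

(* Defs.v *)
From HB Require Import structures.
From mathcomp Require Import all_boot.
From mathcomp Require Import ssralg ssrint.
From mathcomp Require Import boolp.

Set Implicit Arguments.
Unset Strict Implicit.
Unset Printing Implicit Defensive.

Local Open Scope quotient_scope.

(* Composition is written in diagrammatic order: [f ;; g] is [f] followed by
   [g]. *)
Reserved Notation "f ;; g" (at level 50, left associativity).

Record category := Category {
  ob :> Type;
  hom : ob -> ob -> Type;
  idm : forall x, hom x x;
  comp : forall x y z, hom x y -> hom y z -> hom x z
    where "f ;; g" := (comp f g);
  comp1m : forall x y (f : hom x y), idm x ;; f = f;
  compm1 : forall x y (f : hom x y), f ;; idm y = f;
  compA : forall w x y z (f : hom w x) (g : hom x y) (h : hom y z),
    f ;; (g ;; h) = f ;; g ;; h
}.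
Arguments hom {c} x y.
Arguments idm {c} x.
Arguments comp {c x y z} f g.
Notation "f ;; g" := (comp f g).

(* The total type of morphisms, used to compare morphisms whose endpoints are
   not syntactically the same. *)
Record arrow (C : category) := Arrow {
  src : C;
  tgt : C;
  mor : hom src tgt
}.
Arguments Arrow {C src tgt} mor.

Inductive is_identity (C : category) : forall x y : C, hom x y -> Prop :=
  IsIdentity (x : C) : is_identity (idm x).

Record functor (C D : category) := Functor {
  fob :> C -> D;
  fmap : forall x y : C, hom x y -> hom (fob x) (fob y);
  fmap1 : forall x : C, fmap (idm x) = idm (fob x);
  fmapM : forall (x y z : C) (f : hom x y) (g : hom y z),
    fmap (f ;; g) = fmap f ;; fmap g
}.
Arguments fmap {C D} F {x y} f : rename.

Definition farrow (C D : category) (F : functor C D) (a : arrow C) : arrow D :=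
  Arrow (fmap F (mor a)).

(* Since [Arrow (idm x)] determines [x], the two cancellation laws also give
   that [aut_fun] and [aut_inv] are inverse to each other on objects. *)
Record automorphism (C : category) := Automorphism {
  aut_fun :> functor C C;
  aut_inv : functor C C;
  autK : cancel (farrow aut_fun) (farrow aut_inv);
  autVK : cancel (farrow aut_inv) (farrow aut_fun)
}.

Section Lattice.
Variables (T : Type) (le : T -> T -> Prop).

Definition is_partial_order : Prop :=
  [/\ forall a, le a a,
      forall a b, le a b -> le b a -> a = b &
      forall a b c, le a b -> le b c -> le a c].

Definition is_join (a b s : T) : Prop :=
  [/\ le a s, le b s & forall u, le a u -> le b u -> le s u].

Definition is_meet (a b i : T) : Prop :=
  [/\ le i a, le i b & forall u, le u a -> le u b -> le u i].

Definition is_lattice : Prop :=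
  [/\ is_partial_order,
      forall a b, exists s, is_join a b s &
      forall a b, exists i, is_meet a b i].

End Lattice.

Section CategoryProperties.
Variable C : category.

Definition homogeneous : Prop :=
  exists l : forall x y : C, hom x y -> nat,
    (forall (x y z : C) (f : hom x y) (g : hom y z),
       l x z (f ;; g) = l x y f + l y z g) /\
    (forall (x y : C) (f : hom x y), l x y f = 0 <-> is_identity f).

Definition cancellative : Prop :=
  forall (w x y z : C) (a : hom w x) (f g : hom x y) (b : hom y z),
    a ;; f ;; b = a ;; g ;; b -> f = g.

Definition atom (x y : C) (f : hom x y) : Prop :=
  ~ is_identity f /\
  ~ exists (z : C) (g : hom x z) (h : hom z y),
      [/\ ~ is_identity g, ~ is_identity h & f = g ;; h].

Definition arrow_from (x : C) : Type := {y : C & hom x y}.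
Definition arrow_to (x : C) : Type := {y : C & hom y x}.

Definition prefix_le (x : C) (f g : arrow_from x) : Prop :=
  exists h : hom (tag f) (tag g), tagged g = tagged f ;; h.

Definition suffix_ge (x : C) (g h : arrow_to x) : Prop :=
  exists f : hom (tag g) (tag h), tagged g = f ;; tagged h.

End CategoryProperties.

Definition suffix_le (C : category) (x : C) (h g : arrow_to x) : Prop :=
  suffix_ge g h.

Definition simple (C : category) (phi : automorphism C)
    (Delta : forall x : C, hom x (phi x)) (x y : C) (f : hom x y) : Prop :=
  exists fbar : hom y (phi x), f ;; fbar = Delta x.

Record garside_structure := GarsideStructure {
  gcat :> category;
  phi : automorphism gcat;
  Delta : forall x : gcat, hom x (phi x);
  Delta_natural : forall (x y : gcat) (f : hom x y),
    f ;; Delta y = Delta x ;; fmap phi f;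
  gcat_homogeneous : homogeneous gcat;
  gcat_cancellative : cancellative gcat;
  atoms_simple : forall (x y : gcat) (f : hom x y), atom f -> simple Delta f;
  prefix_lattice : forall x : gcat, is_lattice (@prefix_le gcat x);
  suffix_lattice : forall x : gcat, is_lattice (@suffix_le gcat x)
}.
Arguments phi : clear implicits.
Arguments Delta : clear implicits.

Definition cyclic (S : garside_structure) : Prop :=
  exists2 k : nat, 1 <= k & forall a : arrow S, iter k (farrow (phi S)) a = a.

Record groupoid := Groupoid {
  gpd_cat :> category;
  gpd_inv : forall x y : gpd_cat, hom x y -> hom y x;
  gpd_mulVm : forall (x y : gpd_cat) (f : hom x y), gpd_inv f ;; f = idm y;
  gpd_mulmV : forall (x y : gpd_cat) (f : hom x y), f ;; gpd_inv f = idm x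
}.
Arguments gpd_inv {G x y} f : rename.

Section Endomorphisms.
Variables (G : groupoid) (x : G).

Definition endo : Type := hom x x.

HB.instance Definition _ := gen_eqMixin endo.
HB.instance Definition _ := gen_choiceMixin endo.

Fact endo_mulA : associative (fun f g : endo => f ;; g : endo).
Proof. by move=> f g h; apply: compA. Qed.
Fact endo_mul1m : left_id (idm x : endo) (fun f g : endo => f ;; g : endo).
Proof. by move=> f; apply: comp1m. Qed.
Fact endo_mulm1 : right_id (idm x : endo) (fun f g : endo => f ;; g : endo).
Proof. by move=> f; apply: compm1. Qed.
Fact endo_mulVm : left_inverse (idm x : endo) (fun f : endo => gpd_inv f : endo)
  (fun f g : endo => f ;; g : endo).
Proof. by move=> f; apply: gpd_mulVm. Qed.
Fact endo_mulmV : right_inverse (idm x : endo) (fun f : endo => gpd_inv f : endo)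
  (fun f g : endo => f ;; g : endo).
Proof. by move=> f; apply: gpd_mulmV. Qed.

HB.instance Definition _ := isGroup.Build endo
  endo_mulA endo_mul1m endo_mulm1 endo_mulVm endo_mulmV.

End Endomorphisms.

(* The groupoid obtained by formally inverting all morphisms of [C]: formal
   expressions in the morphisms of [C], modulo the least congruence that
   imposes the groupoid axioms and the functoriality of [Gen]. *)
Section GroupoidOfFractions.
Variable C : category.

Inductive gexpr : C -> C -> Type :=
  | Gen x y of hom x y : gexpr x y
  | One x : gexpr x x
  | Mul x y z of gexpr x y & gexpr y z : gexpr x z
  | Inv x y of gexpr x y : gexpr y x.

Inductive gequiv : forall x y : C, gexpr x y -> gexpr x y -> Prop :=
  | gequiv_refl x y (e : gexpr x y) : gequiv e e
  | gequiv_sym x y (e1 e2 : gexpr x y) : gequiv e1 e2 -> gequiv e2 e1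
  | gequiv_trans x y (e1 e2 e3 : gexpr x y) :
      gequiv e1 e2 -> gequiv e2 e3 -> gequiv e1 e3
  | gequiv_mul x y z (e1 e2 : gexpr x y) (e1' e2' : gexpr y z) :
      gequiv e1 e2 -> gequiv e1' e2' -> gequiv (Mul e1 e1') (Mul e2 e2')
  | gequiv_inv x y (e1 e2 : gexpr x y) : gequiv e1 e2 -> gequiv (Inv e1) (Inv e2)
  | gequiv_mulA w x y z (e1 : gexpr w x) (e2 : gexpr x y) (e3 : gexpr y z) :
      gequiv (Mul e1 (Mul e2 e3)) (Mul (Mul e1 e2) e3)
  | gequiv_mul1m x y (e : gexpr x y) : gequiv (Mul (One x) e) e
  | gequiv_mulm1 x y (e : gexpr x y) : gequiv (Mul e (One y)) e
  | gequiv_mulVm x y (e : gexpr x y) : gequiv (Mul (Inv e) e) (One y)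
  | gequiv_mulmV x y (e : gexpr x y) : gequiv (Mul e (Inv e)) (One x)
  | gequiv_gen1 (x : C) : gequiv (Gen (idm x)) (One x)
  | gequiv_genM (x y z : C) (f : hom x y) (g : hom y z) :
      gequiv (Gen (f ;; g)) (Mul (Gen f) (Gen g)).

Section Hom.
Variables x y : C.

Definition gequivb (e1 e2 : {classic gexpr x y}) : bool :=
  `[< @gequiv x y e1 e2 >].

Fact gequivb_refl : reflexive gequivb.
Proof. by move=> e; apply/asboolP/gequiv_refl. Qed.
Fact gequivb_sym : symmetric gequivb.
Proof. by move=> e1 e2; apply/asboolP/asboolP; apply: gequiv_sym. Qed.
Fact gequivb_trans : transitive gequivb.
Proof.
by move=> e2 e1 e3 /asboolP e12 /asboolP e23; apply/asboolP/(gequiv_trans e12).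
Qed.

Canonical gequivb_equiv := EquivRel gequivb gequivb_refl gequivb_sym gequivb_trans.

Definition fhom : Type := {eq_quot gequivb_equiv}.
Definition fclass (e : gexpr x y) : fhom :=
  \pi_({eq_quot gequivb_equiv}) (e : {classic gexpr x y}).
Definition frepr (c : fhom) : gexpr x y :=
  repr (c : {eq_quot gequivb_equiv}).

Lemma freprK (c : fhom) : fclass (frepr c) = c.
Proof. exact: reprK. Qed.

Lemma fclassP (e1 e2 : gexpr x y) : fclass e1 = fclass e2 <-> gequiv e1 e2.
Proof. by split=> [/eqmodP/asboolP|e12] //; apply/eqmodP/asboolP. Qed.

Lemma frepr_class (e : gexpr x y) : gequiv (frepr (fclass e)) e.
Proof. by apply/fclassP; rewrite freprK. Qed.

End Hom.

Definition fmul x y z (f : fhom x y) (g : fhom y z) : fhom x z :=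
  fclass (Mul (frepr f) (frepr g)).
Definition finv x y (f : fhom x y) : fhom y x := fclass (Inv (frepr f)).

Lemma fmulE x y z (e1 : gexpr x y) (e2 : gexpr y z) :
  fmul (fclass e1) (fclass e2) = fclass (Mul e1 e2).
Proof. by apply/fclassP/gequiv_mul; apply: frepr_class. Qed.

Lemma finvE x y (e : gexpr x y) : finv (fclass e) = fclass (Inv e).
Proof. by apply/fclassP/gequiv_inv/frepr_class. Qed.

Fact fmul1m x y (f : fhom x y) : fmul (fclass (One x)) f = f.
Proof. by rewrite -(freprK f) fmulE; apply/fclassP/gequiv_mul1m. Qed.
Fact fmulm1 x y (f : fhom x y) : fmul f (fclass (One y)) = f.
Proof. by rewrite -(freprK f) fmulE; apply/fclassP/gequiv_mulm1. Qed.
Fact fmulA w x y z (f : fhom w x) (g : fhom x y) (h : fhom y z) :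
  fmul f (fmul g h) = fmul (fmul f g) h.
Proof.
rewrite -(freprK f) -(freprK g) -(freprK h) !fmulE.
exact/fclassP/gequiv_mulA.
Qed.
Fact fmulVm x y (f : fhom x y) : fmul (finv f) f = fclass (One y).
Proof. by rewrite -(freprK f) finvE fmulE; apply/fclassP/gequiv_mulVm. Qed.
Fact fmulmV x y (f : fhom x y) : fmul f (finv f) = fclass (One x).
Proof. by rewrite -(freprK f) finvE fmulE; apply/fclassP/gequiv_mulmV. Qed.

Definition fraction_category : category :=
  @Category C fhom (fun x => fclass (One x)) fmul fmul1m fmulm1 fmulA.

Definition fraction_groupoid : groupoid :=
  @Groupoid fraction_category finv fmulVm fmulmV.

Fact gen1 (x : C) : fclass (Gen (idm x)) = fclass (One x).
Proof. exact/fclassP/gequiv_gen1. Qed.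
Fact genM (x y z : C) (f : hom x y) (g : hom y z) :
  fclass (Gen (f ;; g)) = fmul (fclass (Gen f)) (fclass (Gen g)).
Proof. by rewrite fmulE; apply/fclassP/gequiv_genM. Qed.

Definition to_fractions : functor C fraction_groupoid :=
  @Functor C fraction_groupoid id (fun x y f => fclass (Gen f)) gen1 genM.

End GroupoidOfFractions.

Definition garside_groupoid (S : garside_structure) : groupoid :=
  fraction_groupoid S.

Definition weak_garside_group (H : groupType) : Prop :=
  exists (S : garside_structure) (x : garside_groupoid S)
         (f : {multiplicative H -> endo x}), bijective f.

Section DeltaPower.
Variable S : garside_structure.

(* Delta_x ;; Delta_(phi x) ;; ... ;; Delta_(phi^(n-1) x) *)
Fixpoint Delta_nat (n : nat) (x : S) : hom x (iter n (phi S) x) :=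
  match n return hom x (iter n (phi S) x) with
  | 0 => idm x
  | m.+1 => Delta_nat m x ;; Delta S (iter m (phi S) x)
  end.

Definition arrow_inv (G : groupoid) (a : arrow G) : arrow G :=
  Arrow (gpd_inv (mor a)).

(* Delta^p with source [x]. For p = -n with n > 0, this is the inverse of
   the Delta^n with target [x], i.e., with source phi^(-n) x. *)
Definition Delta_pow (p : int) (x : S) : arrow (garside_groupoid S) :=
  match p with
  | Posz n => Arrow (fmap (to_fractions S) (Delta_nat n x))
  | Negz m =>
      let n := m.+1 in
      arrow_inv (Arrow (fmap (to_fractions S)
        (Delta_nat n (iter n (aut_inv (phi S)) x))))
  end.

Definition periodic (x : garside_groupoid S) (g : endo x) : Prop :=
  exists (p : int) (q : nat),
    1 <= q /\ Arrow ((g ^+ q)%g : hom x x) = Delta_pow p x.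

End DeltaPower.

Section Centraliser.
Variables (G : groupType) (g : G).
Local Open Scope group_scope.

Definition centralises : {pred G} := [pred h | g * h == h * g].

Record centraliser := Centraliser {
  centraliser_val :> G;
  _ : centraliser_val \in centralises
}.

HB.instance Definition _ := [isSub for centraliser_val].
HB.instance Definition _ := [Choice of centraliser by <:].

Lemma centralises_group_closed : group_closed centralises.
Proof.
split=> [|h k]; rewrite !inE; first by rewrite mulg1 mul1g.
move=> /eqP gh /eqP gk; apply/eqP.
exact: (commuteM gh (commuteV gk)).
Qed.

HB.instance Definition _ :=
  SubChoice_isSubGroup.Build G centralises centraliser
    centralises_group_closed.

End Centraliser.

(* Main.v *)
From HB Require Import structures.
From mathcomp Require Import all_boot.
From mathcomp Require Import all_order ssralg ssrnum ssrint intdiv.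
From mathcomp Require Import boolp.
Require Import Defs.

Set Implicit Arguments.
Unset Strict Implicit.
Unset Printing Implicit Defensive.

(** The centraliser is recognised as a Garside group through an action.

    Let [Z] be a group acting freely on a lattice [A], with an equivariant
    automorphism [T] of [A] such that [a <= T a], such that every [b > a] has an
    element [c] with [a < c <= b] and [c <= T a], and with an invariant additive
    length of intervals ([garside_action]). The orbits of [Z] in [A], with the
    orbits of pairs [a <= b] as morphisms, form a Garside category whose [Delta]
    is induced by [T] and whose groupoid has vertex groups [Z]
    ([weak_garside_of_action]). Conversely, if [S] is a Garside structure and [x]
    an object, the set of all morphisms of the groupoid with source [x], ordered
    by [f <= f c] for [c] in [S], is a lattice on which the vertex group of [x]
    acts in this way, with [T f = f Delta] ([fraction_action]).

    If now [g ^ q] agrees with [T ^ p] at some point [a0], let [B] be the set of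
    sequences [a : int -> A] that satisfy [a i <= a (i + 1)],
    [a (i + q) = T (a i)] and [a (i + p) = g (a i)]: on them [g] acts as a
    rotation by [p / q] of a full turn [T]. Meets and joins of such sequences are
    taken pointwise, the centraliser of [g] acts pointwise, and the shift
    [a i |-> a (i + 1)] is a [q]-th root of [T] that takes over its part
    ([centraliser_action]). When [g] is trivial, [p = 0] and [q = 1], this is [A]
    itself; in general it corresponds to the fixed points of a rotation of the
    [q]-divided Garside category. The set [B] is not empty: the join over [k] of
    [g ^ k T ^ floor ((i - k p) / q) a0] depends only on [k] modulo [q], hence is
    a finite join, and it has the two required symmetries
    ([eseq_inhabited]). *)

(** * Cancellation in groupoids *)

Section GroupoidTheory.
Variable G : groupoid.

Lemma gpd_mulK (x y z : G) (f : hom x y) (g : hom y z) : f ;; g ;; gpd_inv g = f.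
Proof. by rewrite -compA gpd_mulmV compm1. Qed.

Lemma gpd_mulVK (x y z : G) (f : hom x y) (g : hom z y) :
  f ;; gpd_inv g ;; g = f.
Proof. by rewrite -compA gpd_mulVm compm1. Qed.

Lemma gpd_mulI (x y z : G) (f : hom x y) (g h : hom y z) : f ;; g = f ;; h -> g = h.
Proof.
by move=> /(congr1 (comp (gpd_inv f))); rewrite !compA gpd_mulVm !comp1m.
Qed.

Lemma gpd_mulIr (x y z : G) (f g : hom x y) (h : hom y z) :
  f ;; h = g ;; h -> f = g.
Proof. by move=> /(congr1 (comp^~ (gpd_inv h))); rewrite !gpd_mulK. Qed.

Lemma gpd_invM (x y z : G) (f : hom x y) (g : hom y z) :
  gpd_inv (f ;; g) = gpd_inv g ;; gpd_inv f.
Proof.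
apply: (gpd_mulI (f := f ;; g)).
by rewrite gpd_mulmV compA gpd_mulK gpd_mulmV.
Qed.

Lemma gpd_invK (x y : G) (f : hom x y) : gpd_inv (gpd_inv f) = f.
Proof. by apply: (gpd_mulI (f := gpd_inv f)); rewrite gpd_mulmV gpd_mulVm. Qed.

Lemma gpd_inv1 (x : G) : gpd_inv (idm x) = idm x.
Proof. by apply: (gpd_mulI (f := idm x)); rewrite gpd_mulmV comp1m. Qed.

End GroupoidTheory.

(** * Groupoids of fractions of Ore categories *)

Definition left_ore (C : category) : Prop :=
  forall (w y z : C) (f : hom y z) (g : hom w z),
    exists (v : C) (d : hom v y) (e : hom v w), d ;; f = e ;; g.

Definition right_ore (C : category) : Prop :=
  forall (x y z : C) (f : hom x y) (g : hom x z),
    exists (w : C) (d : hom y w) (e : hom z w), f ;; d = g ;; e.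

(** Lets unification find the groupoid from its underlying category, so that the
   laws of inverses can be used on formal fractions. *)
Canonical fraction_groupoid.

Section Generators.
Variable C : category.
Local Notation G := (fraction_groupoid C).

Definition gen (x y : C) (f : hom x y) : @hom G x y := fclass (Gen f).

Lemma gen_idm (x : C) : gen (idm x) = idm (x : G).
Proof. exact: gen1. Qed.

Lemma gen_comp (x y z : C) (f : hom x y) (g : hom y z) :
  gen (f ;; g) = gen f ;; gen g.
Proof. exact: genM. Qed.

Section LeftOre.
Hypotheses (C_cancel : cancellative C) (C_ore : left_ore C).

Lemma cancel_left (w x y : C) (a : hom w x) (f g : hom x y) :
  a ;; f = a ;; g -> f = g.
Proof.
by move=> e; apply: (C_cancel (a := a) (b := idm y)); rewrite !compm1.
Qed.

Lemma cancel_right (x y z : C) (f g : hom x y) (b : hom y z) :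
  f ;; b = g ;; b -> f = g.
Proof.
by move=> e; apply: (C_cancel (a := idm x) (b := b)); rewrite !comp1m.
Qed.

(** A product of two left fractions is again one: the left Ore condition turns
    the middle factor [b c^-1] into [u^-1 u']. *)
Lemma left_fraction (y z : C) (e : @hom G y z) :
  exists (w : C) (a : hom w y) (b : hom w z), e = gpd_inv (gen a) ;; gen b.
Proof.
rewrite -(freprK e); elim: {e}(frepr e) => {y z}
  [y z f|y|x y z e1 [v [a [b E1]]] e2 [w [c [d E2]]]|x y e [w [a [b E]]]].
- by exists y, (idm y), f; rewrite gen_idm gpd_inv1 comp1m.
- by exists y, (idm y), (idm y); rewrite gen_idm gpd_inv1 comp1m.
- have [t [u [u' ubc]]] := C_ore b c.
  exists t, (u ;; a), (u' ;; d); rewrite -fmulE E1 E2.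
  rewrite -[fmul _ _]/(gpd_inv (gen a) ;; gen b ;; (gpd_inv (gen c) ;; gen d)).
  have bc : gen b ;; gpd_inv (gen c) = gpd_inv (gen u) ;; gen u'.
    apply: (gpd_mulI (f := gen u)); apply: (gpd_mulIr (h := gen c)).
    by rewrite !compA gpd_mulVK gpd_mulmV comp1m -!gen_comp ubc.
  rewrite !gen_comp gpd_invM -[LHS]compA [gen b ;; _]compA bc.
  by rewrite !compA.
- exists w, b, a; rewrite -finvE E.
  by rewrite -[finv _]/(gpd_inv (gpd_inv (gen a) ;; gen b)) gpd_invM gpd_invK.
Qed.

Lemma right_fraction (y z : C) (e : @hom G y z) : right_ore C ->
  exists (w : C) (a : hom y w) (b : hom z w), e = gen a ;; gpd_inv (gen b).
Proof.
move=> C_rore; have [v [a [b ->]]] := left_fraction e.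
have [w [c [d acbd]]] := C_rore _ _ _ a b.
exists w, c, d; apply: (gpd_mulI (f := gen a)); apply: (gpd_mulIr (h := gen d)).
by rewrite !compA gpd_mulmV comp1m gpd_mulVK -!gen_comp acbd.
Qed.

(** A concrete model of formal fractions, which detects when two of them differ:
    [e : x -> y] is interpreted as a correspondence between the morphisms with
    target [x] and those with target [y], [a] being matched with [b] when [b] is
    [a] times [e]. An intermediate value of a product need not lie in the
    category, but it does so after a left multiplication; whence the [d] in the
    case of [Mul]. *)
Fixpoint carries (x y : C) (e : gexpr x y) {struct e} :
    forall w : C, hom w x -> hom w y -> Prop :=
  match e in gexpr x y return forall w : C, hom w x -> hom w y -> Prop with
  | Gen _ _ f => fun w a b => a ;; f = b
  | One _ => fun w a b => a = b
  | Mul _ _ _ e1 e2 => fun w a b =>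
      exists (v : C) (d : hom v w) m, carries e1 (d ;; a) m /\ carries e2 m (d ;; b)
  | Inv _ _ e1 => fun w a b => carries e1 b a
  end.

Lemma carries_mul (x y : C) (e : gexpr x y) (v w : C) (d : hom v w)
  (a : hom w x) (b : hom w y) : carries e (d ;; a) (d ;; b) <-> carries e a b.
Proof.
elim: e v w d a b => {x y}
  [x y f|x|x y z e1 IH1 e2 IH2|x y e IH] v w d a b /=.
- split=> [|<-]; last by rewrite compA.
  by rewrite -compA => /cancel_left.
- by split=> [/cancel_left|->].
- split=> [[u [d' [m]]]|[u [d' [m [am mb]]]]].
    by rewrite !compA => am; exists u, (d' ;; d), m.
  have [t [k [k' kE]]] := C_ore d d'.
  exists t, k, (k' ;; m); rewrite !compA kE -!compA.
  by split; [apply/IH1 | apply/IH2].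
- exact: IH.
Qed.

(** Functionality and injectivity are proved together, as inversion exchanges
    them; likewise for the two halves of [carries_total]. *)
Lemma carries_inj (x y : C) (e : gexpr x y) (w : C) :
  (forall (a : hom w x) (b b' : hom w y), carries e a b -> carries e a b' -> b = b') /\
  (forall (a a' : hom w x) (b : hom w y), carries e a b -> carries e a' b -> a = a').
Proof.
elim: e w => {x y} [x y f|x|x y z e1 IH1 e2 IH2|x y e IH] w /=.
- by split=> [a b b' <- <- //|a a' b <- /cancel_right].
- by split=> [a b b' <- <- //|a a' b -> ->].
- split=> [a b b'|a a' b] [u [d [m [am mb]]]] [u' [d' [m' [am' mb']]]];
    have [t [k [k' kE]]] := C_ore d d';
    have {IH1 IH2} [[F1 B1] [F2 B2]] := (IH1 t, IH2 t);
    apply: (@cancel_left _ _ _ (k ;; d));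
    move/(carries_mul _ k): am; move/(carries_mul _ k): mb;
    move/(carries_mul _ k'): am'; move/(carries_mul _ k'): mb';
    rewrite !compA kE => mb' am' mb am.
  + by move: mb; rewrite (F1 _ _ _ am am') => /F2; apply.
  + by move: am; rewrite (B2 _ _ _ mb mb') => /B1; apply.
- by case: (IH w) => IHf IHi; split=> [a b b'|a a' b]; [apply: IHi|apply: IHf].
Qed.

Lemma carries_total (x y : C) (e : gexpr x y) (w : C) :
  (forall a : hom w x, exists (v : C) (d : hom v w) b, carries e (d ;; a) b) /\
  (forall b : hom w y, exists (v : C) (d : hom v w) a, carries e a (d ;; b)).
Proof.
elim: e w => {x y} [x y f|x|x y z e1 IH1 e2 IH2|x y e IH] w /=.
- split=> [a|b]; first by exists w, (idm w), (idm w ;; a ;; f).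
  by have [v [d [d' dE]]] := C_ore f b; exists v, d', d.
- split=> [a|b]; first by exists w, (idm w), (idm w ;; a).
  by exists w, (idm w), (idm w ;; b).
- split=> [a|b].
    have [v [d [m am]]] := (IH1 w).1 a; have [u [k [b mb]]] := (IH2 v).1 m.
    exists u, (k ;; d), b, u, (idm u), (k ;; m).
    by rewrite !comp1m -compA; split=> //; apply/carries_mul.
  have [v [d [m mb]]] := (IH2 w).2 b; have [u [k [a am]]] := (IH1 v).2 m.
  exists u, (k ;; d), a, u, (idm u), (k ;; m).
  by rewrite !comp1m -compA; split=> //; apply/carries_mul.
- by case: (IH w) => IHf IHi; split=> [a|b]; [apply: IHi|apply: IHf].
Qed.

Lemma carries_equiv (x y : C) (e1 e2 : gexpr x y) : gequiv e1 e2 ->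
  forall (w : C) (a : hom w x) (b : hom w y), carries e1 a b <-> carries e2 a b.
Proof.
move=> E; elim: {x y e1 e2} E =>
  [x y e|x y e1 e2 _ IH|x y e1 e2 e3 _ IH1 _ IH2|x y z e1 e2 e1' e2' _ IH1 _ IH2
  |x y e1 e2 _ IH|v x y z e1 e2 e3|x y e|x y e|x y e|x y e|x|x y z f g] w a b //=.
- by rewrite IH.
- by rewrite IH1.
- by split=> -[u [d [m [am mb]]]]; exists u, d, m; (split; [apply/IH1|apply/IH2]).
- split.
    move=> [u [d [m [am [u' [d' [m' [mm' m'b]]]]]]]].
    exists u', (d' ;; d), m'; split; last by rewrite -compA.
    exists u', (idm u'), (d' ;; m); rewrite !comp1m -compA.
    by split=> //; apply/carries_mul.
  move=> [u [d [m' [[u' [d' [m [am mm']]]] m'b]]]].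
  exists u', (d' ;; d), m; rewrite -compA; split=> //.
  exists u', (idm u'), (d' ;; m'); rewrite !comp1m -compA.
  by split=> //; apply/carries_mul.
- split=> [[u [d [m [<- mb]]]]|ab]; first exact/(carries_mul _ d).
  by exists w, (idm w), a; rewrite !comp1m.
- split=> [[u [d [m [am mb]]]]|ab]; first by move: am; rewrite mb => /carries_mul.
  by exists w, (idm w), b; rewrite !comp1m.
- split=> [[u [d [m [am mb]]]]|<-].
    exact: cancel_left ((carries_inj e u).1 _ _ _ am mb).
  by have [u [d [m am]]] := (carries_total e w).2 a; exists u, d, m.
- split=> [[u [d [m [am mb]]]]|<-].
    exact: cancel_left ((carries_inj e u).2 _ _ _ am mb).
  by have [u [d [m am]]] := (carries_total e w).1 a; exists u, d, m.
- by rewrite compm1.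
- split=> [<-|[u [d [m [<-]]]]].
    by exists w, (idm w), (a ;; f); rewrite !comp1m compA.
  by rewrite -!compA => /cancel_left; rewrite compA.
Qed.

(** The category embeds in its groupoid of fractions: under [Gen f], the identity
    is matched with [f] only. *)
Lemma gen_inj (x y : C) : injective (@gen x y).
Proof.
move=> f g /fclassP/carries_equiv/(_ _ (idm x) f) /=.
by rewrite !comp1m => -[/(_ erefl) ->].
Qed.

End LeftOre.
End Generators.

Lemma suffix_left_ore (S : garside_structure) : left_ore S.
Proof.
move=> w y z f g.
have [_ /(_ (existT _ y f) (existT _ w g)) [[v h] [[d dE] [e eE] _]] _] := suffix_lattice z.
by exists v, d, e; rewrite -dE -eE.
Qed.

Lemma prefix_right_ore (S : garside_structure) : right_ore S.
Proof.
move=> x y z f g.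
have [_ /(_ (existT _ y f) (existT _ z g)) [[v h] [[d dE] [e eE] _]] _] := prefix_lattice x.
by exists v, d, e; rewrite -dE -eE.
Qed.

(** * Group actions on Garside lattices *)

(** The hypotheses on joins and meets ask for bounds in the image of [h]: an
    order embedding alone need not preserve them. *)
Lemma lattice_transport (T U : Type) (leT : T -> T -> Prop) (leU : U -> U -> Prop)
    (h : T -> U) :
  injective h -> (forall a b, leT a b <-> leU (h a) (h b)) ->
  is_partial_order leU ->
  (forall a b, exists s, is_join leU (h a) (h b) (h s)) ->
  (forall a b, exists i, is_meet leU (h a) (h b) (h i)) -> is_lattice leT.
Proof.
move=> h_inj hE [refl anti trans] joins meets; split.
- split=> [a|a b /hE ab /hE ba|a b c /hE ab /hE bc]; first exact/hE.
    exact/h_inj/anti.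
  exact/hE/(trans _ _ _ ab).
- move=> a b; have [s [sa sb sP]] := joins a b; exists s.
  by split; [exact/hE|exact/hE|move=> u /hE ua /hE ub; apply/hE/sP].
- move=> a b; have [i [ia ib iP]] := meets a b; exists i.
  by split; [exact/hE|exact/hE|move=> u /hE ua /hE ub; apply/hE/iP].
Qed.

(** The data from which the Garside category of orbits is built. [ga_step] is the
    property from which atoms are shown to be simple; it speaks of all intervals
    rather than of the minimal ones, so that it can be verified for the
    equivariant sequences below without knowing their atoms. The length is left
    existential, as no construction depends on a choice of it. *)
Record garside_action (Z : groupType) := GarsideAction {
  ga_sort :> Type;
  ga_le : ga_sort -> ga_sort -> Prop;
  ga_lattice : is_lattice ga_le;
  ga_act : Z -> ga_sort -> ga_sort;
  ga_act1 : forall a, ga_act 1%g a = a;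
  ga_actM : forall z w a, ga_act (z * w)%g a = ga_act z (ga_act w a);
  ga_free : forall z a, ga_act z a = a -> z = 1%g;
  ga_act_le : forall z a b, ga_le a b -> ga_le (ga_act z a) (ga_act z b);
  ga_shift : ga_sort -> ga_sort;
  ga_shift_le : forall a b, ga_le (ga_shift a) (ga_shift b) <-> ga_le a b;
  ga_shift_onto : forall b, exists a, ga_shift a = b;
  ga_shift_act : forall z a, ga_shift (ga_act z a) = ga_act z (ga_shift a);
  ga_le_shift : forall a, ga_le a (ga_shift a);
  ga_step : forall a b, ga_le a b -> a <> b ->
    exists c, [/\ ga_le a c, a <> c, ga_le c b & ga_le c (ga_shift a)];
  ga_length : exists len : ga_sort -> ga_sort -> nat,
    [/\ forall a b c, ga_le a b -> ga_le b c -> len a c = len a b + len b c,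
        forall a b, ga_le a b -> len a b = 0 -> a = b &
        forall z a b, len (ga_act z a) (ga_act z b) = len a b]
}.

Section ActionTheory.
Variables (Z : groupType) (A : garside_action Z).
Local Notation le := (@ga_le Z A).
Local Notation "z • a" := (@ga_act Z A z a) (at level 35, right associativity).
Implicit Types (a b c : A) (z w : Z).

Lemma ga_refl a : le a a.
Proof. by have [[+ _ _] _ _] := ga_lattice A. Qed.
Lemma ga_anti a b : le a b -> le b a -> a = b.
Proof. by have [[_ + _] _ _] := ga_lattice A; apply. Qed.
Lemma ga_trans b a c : le a b -> le b c -> le a c.
Proof. by have [[_ _ +] _ _] := ga_lattice A; apply. Qed.

Lemma actKV z a : z^-1%g • z • a = a.
Proof. by rewrite -ga_actM mulVg ga_act1. Qed.

Lemma actVK z a : z • z^-1%g • a = a.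
Proof. by rewrite -ga_actM mulgV ga_act1. Qed.

Lemma act_leE z a b : le (z • a) (z • b) <-> le a b.
Proof.
split; last exact: ga_act_le.
by move=> /(ga_act_le z^-1%g); rewrite !actKV.
Qed.

Lemma act_inj a z w : z • a = w • a -> z = w.
Proof.
move=> e; apply/esym/(mulgI z^-1%g); rewrite mulVg.
by apply: (@ga_free _ _ _ a); rewrite ga_actM -e actKV.
Qed.

Lemma ga_shift_inj : injective (@ga_shift Z A).
Proof.
by move=> a b e; apply: ga_anti; apply/ga_shift_le; rewrite e; apply: ga_refl.
Qed.

Definition ga_unshift : A -> A := projT1 (choice (@ga_shift_onto Z A)).

Lemma ga_unshiftK : cancel ga_unshift (@ga_shift Z A).
Proof. exact: projT2 (choice (@ga_shift_onto Z A)). Qed.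

Lemma ga_shiftK : cancel (@ga_shift Z A) ga_unshift.
Proof. by move=> a; apply: ga_shift_inj; rewrite ga_unshiftK. Qed.

Lemma ga_unshift_le a b : le a b -> le (ga_unshift a) (ga_unshift b).
Proof. by move=> ab; apply/ga_shift_le; rewrite !ga_unshiftK. Qed.

Lemma ga_unshift_act z a : ga_unshift (z • a) = z • ga_unshift a.
Proof. by apply: ga_shift_inj; rewrite ga_shift_act !ga_unshiftK. Qed.

End ActionTheory.

(** * The Garside category of orbits *)

Section OrbitCategory.
Variables (Z : groupType) (A : garside_action Z).
Local Notation le := (@ga_le Z A).
Local Notation "z • a" := (@ga_act Z A z a) (at level 35, right associativity).
Implicit Types (a b c : A) (z w : Z).

Definition orbit_of a : A -> Prop := fun b => exists z, a = z • b.

Lemma orbit_of_inhabited a : exists b, orbit_of a b.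
Proof. by exists a, 1%g; rewrite ga_act1. Qed.

(** The representative depends on the orbit only, as a predicate; this is what
   [rep_act] expresses. *)
Definition rep a : A := projT1 (cid (orbit_of_inhabited a)).

Lemma rep_orbit a : orbit_of a (rep a).
Proof. exact: projT2 (cid (orbit_of_inhabited a)). Qed.

Lemma rep_act z a : rep (z • a) = rep a.
Proof.
rewrite /rep; move: (orbit_of_inhabited _) (orbit_of_inhabited _).
suff -> : orbit_of (z • a) = orbit_of a by move=> p q; rewrite (Prop_irrelevance p q).
apply/funext=> b; apply/propext; split=> -[w].
  by move=> e; exists (z^-1 * w)%g; rewrite ga_actM -e actKV.
by move=> ->; exists (z * w)%g; rewrite ga_actM.
Qed.

Definition trans a : Z := projT1 (cid (rep_orbit a)).

Lemma transE a : trans a • rep a = a.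
Proof. by rewrite /trans; case: cid. Qed.

Lemma transVE a : (trans a)^-1%g • a = rep a.
Proof. by rewrite -{2}(transE a) actKV. Qed.

Lemma rep_rep a : rep (rep a) = rep a.
Proof. by rewrite -[in RHS](transE a) rep_act. Qed.

Lemma trans_act z a : rep a = a -> trans (z • a) = z.
Proof.
by move=> ra; apply: (@act_inj _ A a); rewrite -{2}ra -(rep_act z) transE.
Qed.

(** The objects are one point in each orbit. Taking all points as objects would
    give an equivalent category, but with isomorphisms that are not identities,
    which homogeneity excludes. A morphism from [a] to [b] is an element [z] with
    [a <= z b], which stands for the orbit of the pair [(a, z b)]. *)
Definition orep : Type := {a : A | rep a = a}.
Definition ohom (x y : orep) : Type := {z : Z | le (sval x) (z • sval y)}.

Lemma orep_eq (x y : orep) : sval x = sval y -> x = y.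
Proof. by case: x y => [a ra] [b rb] /= ab; apply: eq_exist. Qed.

Lemma ohom_eq (x y : orep) (f g : ohom x y) : sval f = sval g -> f = g.
Proof. by case: f g => [a ra] [b rb] /= ab; apply: eq_exist. Qed.

Definition oidm (x : orep) : ohom x x.
Proof. by exists 1%g; rewrite ga_act1; apply: ga_refl. Defined.

Definition ocomp (x y z : orep) (f : ohom x y) (g : ohom y z) : ohom x z.
Proof.
exists (sval f * sval g)%g; rewrite ga_actM.
exact: ga_trans (svalP f) (ga_act_le _ (svalP g)).
Defined.

Definition orbit_category : category.
Proof.
apply: (@Category orep ohom oidm ocomp) => *; apply: ohom_eq => /=.
- exact: mul1g.
- exact: mulg1.
- exact: mulgA.
Defined.
Local Notation C := orbit_category.

Definition obj a : C := exist (fun a => rep a = a) (rep a) (rep_rep a).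

Definition label (x y : C) (f : hom x y) : Z := sval f.
Definition point (x : C) : A := sval x.

Lemma label_comp (x y z : C) (f : hom x y) (g : hom y z) :
  label (f ;; g) = (label f * label g)%g.
Proof. by []. Qed.

Lemma label_le (x y : C) (f : hom x y) : le (point x) (label f • point y).
Proof. exact: svalP f. Qed.

Lemma label_inj (x y : C) (f g : hom x y) : label f = label g -> f = g.
Proof. exact: ohom_eq. Qed.

Lemma rep_point (x : C) : rep (point x) = point x.
Proof. exact: svalP x. Qed.

Definition ohom_of (x y : C) z (h : le (point x) (z • point y)) : @hom C x y :=
  exist _ z h.

Lemma arrow_eq (x y x' y' : C) (f : hom x y) (f' : hom x' y') :
  point x = point x' -> point y = point y' -> label f = label f' ->
  Arrow f = Arrow f'.
Proof.
move=> /orep_eq xx' /orep_eq yy'; move: f f'; case: _ / xx'; case: _ / yy'.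
by move=> f f' /label_inj ->.
Qed.

(** A pair [a <= z b] of arbitrary points is a morphism between their
    representatives, once [z] is corrected by the translations to these. *)
Lemma obj_le a b z : le a (z • b) ->
  le (point (obj a)) (((trans a)^-1 * z * trans b)%g • point (obj b)).
Proof. by move=> ab; rewrite /= -transVE -mulgA ga_actM act_leE ga_actM transE. Qed.

Section EquivariantFunctor.
Variable g : A -> A.
Hypothesis g_le : forall a b, le a b -> le (g a) (g b).
Hypothesis g_act : forall z a, g (z • a) = z • g a.

Lemma equivariant_le (x y : C) (f : hom x y) :
  le (g (point x)) (label f • g (point y)).
Proof. by rewrite -g_act; apply/g_le/label_le. Qed.

Definition equivariant_functor : functor C C.
Proof.
apply: (@Functor C C (fun x => obj (g (point x)))
  (fun x y f => ohom_of (obj_le (equivariant_le f)))) => [x|x y z f h].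
  by apply: label_inj; rewrite /label /= mulg1 mulVg.
by apply: label_inj; rewrite /label /= !mulgA mulgK.
Defined.

End EquivariantFunctor.

(** Inverse automorphisms of the lattice induce inverse functors on the nose: if
    [a] is a chosen representative then [h (rep (g a))] lies in the orbit of
    [a], so that its own representative is [a] again. *)
Lemma equivariant_functorK (g h : A -> A) g_le g_act h_le h_act : cancel g h ->
  cancel (farrow (@equivariant_functor g g_le g_act))
         (farrow (@equivariant_functor h h_le h_act)).
Proof.
move=> gK [x y f].
have hg (u : C) : h (rep (g (point u))) = (trans (g (point u)))^-1%g • point u.
  by rewrite -transVE h_act gK.
apply: arrow_eq => /=.
- by rewrite hg rep_act rep_point.
- by rewrite hg rep_act rep_point.
rewrite /label /= !hg !trans_act ?rep_point //.
by rewrite invgK !mulgA mulgV mul1g mulgK.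
Qed.

Definition orbit_shift : automorphism C :=
  Automorphism
    (equivariant_functorK (fun a b => proj2 (@ga_shift_le _ A a b))
       (@ga_shift_act _ A) (@ga_unshift_le _ A) (@ga_unshift_act _ A)
       (@ga_shiftK _ A))
    (equivariant_functorK (@ga_unshift_le _ A) (@ga_unshift_act _ A)
       (fun a b => proj2 (@ga_shift_le _ A a b)) (@ga_shift_act _ A)
       (@ga_unshiftK _ A)).

Lemma orbit_Delta_le (x : C) :
  le (point x) (trans (ga_shift (point x)) • point (orbit_shift x)).
Proof. by rewrite /= transE; apply: ga_le_shift. Qed.

Definition orbit_Delta (x : C) : hom x (orbit_shift x) := ohom_of (orbit_Delta_le x).

Lemma orbit_Delta_natural (x y : C) (f : hom x y) :
  f ;; orbit_Delta y = orbit_Delta x ;; fmap orbit_shift f.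
Proof. by apply: label_inj; rewrite /label /= !mulgA mulgV mul1g. Qed.

(** If [a = z b] for chosen representatives [a] and [b], these coincide, and [z] is
    trivial since the action is free. *)
Lemma orbit_identity (x y : C) (f : hom x y) :
  is_identity f <-> point x = label f • point y.
Proof.
split=> [[z]|]; first by rewrite ga_act1.
move=> xy; have e : x = y.
  by apply: orep_eq; rewrite -[LHS]rep_point xy rep_act rep_point.
move: f xy; case: _ / e => f xy.
suff -> : f = idm x by [].
by apply/label_inj/(@ga_free _ A _ (point x)).
Qed.

Lemma orbit_homogeneous : homogeneous C.
Proof.
have [len [lenD len0 len_act]] := ga_length A.
have len_refl a : len a a = 0.
  have /eqP := lenD _ _ _ (ga_refl a) (ga_refl a).
  by rewrite -{1}[len a a]addn0 eqn_add2l => /eqP.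
exists (fun x y f => len (point x) (label f • point y)); split=> [x y z f g|x y f].
  rewrite label_comp ga_actM -(len_act (label f) (point y)); apply: lenD.
    exact: label_le.
  exact/ga_act_le/label_le.
rewrite orbit_identity; split=> [/len0|<- //]; apply; exact: label_le.
Qed.

Lemma orbit_cancellative : cancellative C.
Proof.
move=> w x y z a f g b /(congr1 (@label _ _)); rewrite !label_comp.
by move=> /mulIg/mulgI/label_inj.
Qed.

(** The factorisations of a morphism correspond to the points of an interval of the
    lattice. *)
Lemma orbit_factor (x y : C) (f : hom x y) c :
  le (point x) c -> le c (label f • point y) ->
  exists (g : hom x (obj c)) (h : hom (obj c) y),
    f = g ;; h /\ label g • point (obj c) = c.
Proof.
move=> xc cy.
have gle : le (point x) (trans c • point (obj c)) by rewrite transE.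
have hle : le (point (obj c)) (((trans c)^-1 * label f)%g • point y).
  by rewrite /= -transVE ga_actM act_leE.
exists (ohom_of gle), (ohom_of hle); split; last exact: transE.
by apply: label_inj; rewrite label_comp /label /= mulgA mulgV mul1g.
Qed.

(** By [ga_step] some point of the interval of [f], other than its origin, lies below
    the shifted origin; for an atom this can only be its end. *)
Lemma orbit_atoms_simple (x y : C) (f : hom x y) : atom f -> simple orbit_Delta f.
Proof.
move=> [f_nid f_irr].
have [c [xc nxc cy cD]] := ga_step (label_le f) (fun e => f_nid ((orbit_identity f).2 e)).
have [g [h [fE gc]]] := orbit_factor xc cy.
have cE : c = label f • point y.
  have : is_identity h.
    apply: contrapT => h_nid; apply: f_irr; exists (obj c), g, h; split=> //.
    by move=> /orbit_identity; rewrite gc.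
  by move=> /orbit_identity e; rewrite fE label_comp ga_actM -e gc.
have hle : le (point y) (((label f)^-1 * label (orbit_Delta x))%g
                           • point (orbit_shift x)).
  by rewrite ga_actM -(act_leE (label f)) actVK -cE /label /= transE.
exists (ohom_of hle).
by apply: label_inj; rewrite label_comp /label /= mulgA mulgV mul1g.
Qed.

(** These two maps identify the morphisms with source [x] with the points above [x],
   and those with target [x] with the points below [x]. *)
Definition endpoint (x : C) (f : arrow_from x) : A :=
  label (tagged f) • point (tag f).

Definition startpoint (x : C) (f : arrow_to x) : A :=
  (label (tagged f))^-1%g • point (tag f).

Lemma point_act_inj (x y : C) z w : z • point x = w • point y -> x = y /\ z = w.
Proof.
move=> e; have xy : x = y.
  apply: orep_eq; move: (congr1 rep e).
  by rewrite !rep_act !rep_point.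
by split=> //; move: e; rewrite xy => /act_inj.
Qed.

Lemma endpoint_inj (x : C) : injective (@endpoint x).
Proof.
move=> [y f] [y' f']; rewrite /endpoint /= => /point_act_inj [yy'].
by move: f'; case: _ / yy' => f' /label_inj ->.
Qed.

Lemma startpoint_inj (x : C) : injective (@startpoint x).
Proof.
move=> [y f] [y' f']; rewrite /startpoint /= => /point_act_inj [yy'].
by move: f'; case: _ / yy' => f' /invg_inj/label_inj ->.
Qed.

Lemma prefix_leE (x : C) (f g : arrow_from x) :
  prefix_le f g <-> le (endpoint f) (endpoint g).
Proof.
case: f g => [y f] [z g]; rewrite /prefix_le /endpoint /=; split=> [[h ->]|fg].
  by rewrite label_comp ga_actM act_leE; apply: label_le.
have hle : le (point y) (((label f)^-1 * label g)%g • point z).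
  by rewrite ga_actM -(act_leE (label f)) actVK.
by exists (ohom_of hle); apply: label_inj; rewrite label_comp /label /= mulgA mulgV mul1g.
Qed.

Lemma suffix_leE (x : C) (f g : arrow_to x) :
  suffix_le f g <-> le (startpoint g) (startpoint f).
Proof.
case: f g => [y f] [z g]; rewrite /suffix_le /suffix_ge /startpoint /=.
split=> [[h ->]|gf].
  rewrite label_comp invgM ga_actM act_leE -(act_leE (label h)) actVK.
  exact: label_le.
have hle : le (point z) ((label g * (label f)^-1)%g • point y).
  by rewrite ga_actM -(act_leE (label g)^-1%g) actKV.
by exists (ohom_of hle); apply: label_inj; rewrite label_comp /label /= mulgVK.
Qed.

Lemma endpoint_onto (x : C) c : le (point x) c ->
  exists f : arrow_from x, endpoint f = c.
Proof.
move=> xc.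
have hle : le (point x) (trans c • point (obj c)) by rewrite transE.
by exists (existT _ (obj c) (ohom_of hle)); apply: transE.
Qed.

Lemma startpoint_onto (x : C) c : le c (point x) ->
  exists f : arrow_to x, startpoint f = c.
Proof.
move=> cx.
have hle : le (point (obj c)) ((trans c)^-1%g • point x).
  by rewrite /= -transVE act_leE.
by exists (existT _ (obj c) (ohom_of hle)); rewrite /startpoint /label /= invgK transE.
Qed.

Lemma le_endpoint (x : C) (f : arrow_from x) : le (point x) (endpoint f).
Proof. exact: label_le. Qed.

Lemma startpoint_le (x : C) (f : arrow_to x) : le (startpoint f) (point x).
Proof. by rewrite -(act_leE (label (tagged f))) actVK; apply: label_le. Qed.

Lemma orbit_prefix_lattice (x : C) : is_lattice (@prefix_le C x).
Proof.
have [_ joins meets] := ga_lattice A.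
apply: (lattice_transport (@endpoint_inj x) (@prefix_leE x)) => [|f g|f g].
- by case: (ga_lattice A).
- have [s sP] := joins (endpoint f) (endpoint g); have [fs _ _] := sP.
  have [h hE] := endpoint_onto (ga_trans (le_endpoint f) fs).
  by exists h; rewrite hE.
- have [i iP] := meets (endpoint f) (endpoint g); have [_ _ i_max] := iP.
  have [h hE] := endpoint_onto (i_max _ (le_endpoint f) (le_endpoint g)).
  by exists h; rewrite hE.
Qed.

(** The order is reversed here: the longer a morphism to [x], the lower its
    starting point. *)
Lemma orbit_suffix_lattice (x : C) : is_lattice (@suffix_le C x).
Proof.
have [_ joins meets] := ga_lattice A.
apply: (lattice_transport (leU := fun a b => le b a)
  (@startpoint_inj x) (@suffix_leE x)) => [|f g|f g].
- split=> [a|a b ab ba|a b c ba cb]; [exact: ga_refl|exact: ga_anti|].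
  exact: ga_trans cb ba.
- have [i iP] := meets (startpoint f) (startpoint g); have [fi _ _] := iP.
  have [h hE] := startpoint_onto (ga_trans fi (startpoint_le f)).
  by exists h; rewrite hE.
- have [s sP] := joins (startpoint f) (startpoint g); have [_ _ s_min] := sP.
  have [h hE] := startpoint_onto (s_min _ (startpoint_le f) (startpoint_le g)).
  by exists h; rewrite hE.
Qed.

Definition orbit_garside : garside_structure :=
  GarsideStructure orbit_Delta_natural orbit_homogeneous orbit_cancellative
    orbit_atoms_simple orbit_prefix_lattice orbit_suffix_lattice.

(** The universal property of the groupoid of fractions, for the functor to the group
    that is given by labels. *)
Fixpoint glabel (x y : C) (e : gexpr x y) : Z :=
  match e with
  | Gen _ _ f => label f
  | One _ => 1
  | Mul _ _ _ e1 e2 => glabel e1 * glabel e2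
  | Inv _ _ e1 => (glabel e1)^-1
  end%g.

Lemma glabel_equiv (x y : C) (e1 e2 : gexpr x y) :
  gequiv e1 e2 -> glabel e1 = glabel e2.
Proof.
move=> E; elim: {x y e1 e2} E => //=.
- by move=> x y e1 e2 e3 _ -> _ ->.
- by move=> x y z e1 e2 e1' e2' _ -> _ ->.
- by move=> x y e1 e2 _ ->.
- by move=> *; rewrite mulgA.
- by move=> *; rewrite mul1g.
- by move=> *; rewrite mulg1.
- by move=> *; rewrite mulVg.
- by move=> *; rewrite mulgV.
Qed.

Local Notation G := (garside_groupoid orbit_garside).

Definition flabel (x y : G) (f : hom x y) : Z := glabel (frepr f).

Lemma flabel_class (x y : C) (e : gexpr x y) : flabel (fclass e : @hom G x y) = glabel e.
Proof. exact/glabel_equiv/frepr_class. Qed.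

Lemma flabel_comp (x y z : G) (f : hom x y) (g : hom y z) :
  flabel (f ;; g) = (flabel f * flabel g)%g.
Proof. exact: flabel_class. Qed.

Lemma flabel_inv (x y : G) (f : hom x y) : flabel (gpd_inv f) = (flabel f)^-1%g.
Proof. exact: flabel_class. Qed.

Lemma flabel_gen (x y : C) (f : hom x y) : flabel (gen f) = label f.
Proof. exact: flabel_class. Qed.

(** For any common upper bound [s] of the points [a] and [z a], the loop from [a]
    to [s] and back from [s] to [z a] is a fraction of label [z]. *)
Lemma flabel_onto (x : G) z : exists f : hom x x, flabel f = z.
Proof.
have [_ /(_ (point x) (z • point x)) [s [xs zxs _]] _] := ga_lattice A.
have fle : le (point x) (trans s • point (obj s)) by rewrite transE.
have gle : le (point x) ((z^-1 * trans s)%g • point (obj s)).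
  by rewrite ga_actM transE -(act_leE z) actVK.
exists (gen (ohom_of fle) ;; gpd_inv (gen (ohom_of gle))).
rewrite flabel_comp flabel_inv !flabel_gen /label /=.
by rewrite invgM invgK mulgA mulgV mul1g.
Qed.

End OrbitCategory.

(** A left fraction [a^-1 b] of trivial label has [a] and [b] of equal labels. *)
Lemma flabel_inj (Z : groupType) (A : garside_action Z)
  (x : garside_groupoid (orbit_garside A)) :
  injective (@flabel Z A x x).
Proof.
move=> f g fg; apply: (gpd_mulIr (h := gpd_inv g)); rewrite gpd_mulmV.
have : flabel (f ;; gpd_inv g) = 1%g by rewrite flabel_comp flabel_inv fg mulgV.
move: (f ;; gpd_inv g) => {f g fg} e.
have [w [a [b ->]]] := left_fraction (@suffix_left_ore (orbit_garside A)) e.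
rewrite flabel_comp flabel_inv !flabel_gen => /mulg1_eq.
by rewrite invgK => /label_inj ->; rewrite gpd_mulVm.
Qed.

Theorem weak_garside_of_action (Z : groupType) (A : garside_action Z) (a : A) :
  weak_garside_group Z.
Proof.
pose x : garside_groupoid (orbit_garside A) := obj a.
have [g gK] := choice (@flabel_onto Z A x).
have Kg : cancel (@flabel Z A x x) g by move=> f; apply: flabel_inj; rewrite gK.
have gM : {morph g : z w / (z * w)%g >-> ((z : endo x) * w)%g}.
  by move=> z w; apply: flabel_inj; rewrite gK flabel_comp !gK.
pose gm := isMultiplicative.Build Z (endo x) g gM.
pose h : {multiplicative Z -> endo x} := HB.pack (g : Z -> endo x) gm.
by exists (orbit_garside A), x, h; exists (@flabel Z A x x).
Qed.

(** * The lattice of fractions *)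

Lemma existT_inj (T : Type) (P : T -> Type) (t : T) : injective (existT P t).
Proof.
move=> a b e; have := projT2_eq e.
by rewrite (Prop_irrelevance (projT1_eq e) erefl).
Qed.

Lemma arrow_inj (C : category) (x y : C) : injective (@Arrow C x y).
Proof.
move=> f g /(congr1 (fun a => existT (fun u => hom u.1 u.2) (src a, tgt a) (mor a))).
exact: existT_inj.
Qed.

Local Arguments comp : simpl never.
Local Arguments gpd_inv : simpl never.
Local Arguments idm : simpl never.

Section FractionLattice.
Variables (S : garside_structure) (x : garside_groupoid S).
Local Notation G := (garside_groupoid S).

Lemma genS_inj (y z : S) : injective (@gen S y z).
Proof. exact: gen_inj (gcat_cancellative (g := S)) (@suffix_left_ore S) y z. Qed.

Definition fraction : Type := {y : G & @hom G x y}.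

Definition fraction_le (f g : fraction) : Prop :=
  exists c : @hom S (tag f) (tag g), tagged g = tagged f ;; gen c.

(** Homogeneity: the length of an identity is zero. *)
Lemma identity_of_divisor (y z : S) (c : hom y z) (d : hom z y) :
  c ;; d = idm y -> is_identity c.
Proof.
have [l [lD l0]] := gcat_homogeneous S => cd.
have /eqP : l y y (c ;; d) = 0 by apply/l0; rewrite cd.
by rewrite lD addn_eq0 => /andP[/eqP/l0].
Qed.

Lemma fraction_partial_order : is_partial_order fraction_le.
Proof.
split=> [[y f]|[y f] [z g] [/= c gE] [/= d fE]|[y f] [z g] [w h] [/= c gE] [/= d hE]].
- by exists (idm (y : S)); rewrite gen_idm compm1.
- have : is_identity c.
    apply: (identity_of_divisor (d := d)); apply: genS_inj.
    apply: (gpd_mulI (f := f)).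
    by rewrite gen_comp gen_idm compA -gE -fE compm1.
  move: gE {fE d} => -> {g} cid; case: {y z c} cid f => y f.
  by rewrite gen_idm compm1.
- by exists (c ;; d); rewrite /= gen_comp hE gE compA.
Qed.

(** Two fractions [f] and [g] have a common lower bound [h], by writing [f^-1 g] as a
    left fraction. Everything above [h] is [h] times a morphism of the category,
    so that the join can be computed there. Meets are dual, below a common upper
    bound. *)
Lemma fraction_joins (f g : fraction) : exists s, is_join fraction_le f g s.
Proof.
case: f g => [y f] [z g].
have [w [a [b E]]] := left_fraction (@suffix_left_ore S) (gpd_inv f ;; g).
pose h := f ;; gpd_inv (gen a).
have fE : f = h ;; gen a by rewrite gpd_mulVK.
have gE : g = h ;; gen b.
  by apply: (gpd_mulI (f := gpd_inv f)); rewrite E -compA compA gpd_mulVm comp1m.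
pose e (c : arrow_from w) : fraction := existT _ (tag c : G) (h ;; gen (tagged c)).
have eE (c c' : arrow_from w) : fraction_le (e c) (e c') <-> prefix_le c c'.
  split=> -[d dE]; exists d.
    by apply/genS_inj/(gpd_mulI (f := h)); rewrite gen_comp compA.
  by rewrite /= dE gen_comp compA.
have [_ /(_ (existT _ y a) (existT _ z b)) [s [sa sb s_min]] _] := prefix_lattice w.
rewrite fE gE -[existT _ _ _]/(e (existT _ y a)) -[existT _ z _]/(e (existT _ z b)).
exists (e s); split; [exact/eE|exact/eE|].
move=> [u k] [/= c kE] bk.
have uE : existT _ u k = e (existT _ u (a ;; c)) by rewrite /e /= gen_comp kE compA.
by rewrite uE in bk *; apply/eE/s_min; [exists c|apply/eE].
Qed.

Lemma fraction_meets (f g : fraction) : exists i, is_meet fraction_le f g i.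
Proof.
case: f g => [y f] [z g].
have [w [a [b E]]] := right_fraction (@suffix_left_ore S) (gpd_inv f ;; g)
  (@prefix_right_ore S).
pose h := f ;; gen a.
have fE : f = h ;; gpd_inv (gen a) by rewrite gpd_mulK.
have gE : g = h ;; gpd_inv (gen b).
  by apply: (gpd_mulI (f := gpd_inv f)); rewrite E -compA compA gpd_mulVm comp1m.
pose e (c : arrow_to w) : fraction :=
  existT _ (tag c : G) (h ;; gpd_inv (gen (tagged c))).
have eE (c c' : arrow_to w) : fraction_le (e c') (e c) <-> suffix_le c c'.
  split=> -[/= d dE]; exists d.
    apply/genS_inj/(gpd_mulI (f := h ;; gpd_inv (gen (tagged c')))).
    by rewrite gen_comp compA -dE !gpd_mulVK.
  by rewrite /= dE gen_comp gpd_invM compA gpd_mulVK.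
have [_ /(_ (existT _ y a) (existT _ z b)) [s [sa sb s_min]] _] := suffix_lattice w.
rewrite fE gE -[existT _ _ _]/(e (existT _ y a)) -[existT _ z _]/(e (existT _ z b)).
exists (e s); split; [exact/eE|exact/eE|].
move=> [u k] [/= c kE] bk.
have uE : existT _ u k = e (existT _ u (c ;; a)).
  by rewrite /e /= gen_comp gpd_invM compA kE gpd_mulK.
by rewrite uE in bk *; apply/eE/s_min; [exists c|apply/eE].
Qed.

Lemma fraction_lattice : is_lattice fraction_le.
Proof.
by split; [exact: fraction_partial_order|exact: fraction_joins|exact: fraction_meets].
Qed.

Definition fraction_act (z : endo x) (f : fraction) : fraction :=
  existT _ (tag f) (z ;; tagged f).

Lemma fraction_act1 f : fraction_act 1%g f = f.
Proof. by case: f => [y f]; rewrite /fraction_act /= [(1%g : endo x) ;; _]comp1m. Qed.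

Lemma fraction_actM z w f :
  fraction_act (z * w)%g f = fraction_act z (fraction_act w f).
Proof. by rewrite /fraction_act /= -[(z ;; w : endo x) ;; _]compA. Qed.

Lemma fraction_free z f : fraction_act z f = f -> z = 1%g.
Proof.
case: f => [y f] e; have zf : z ;; f = f := existT_inj e.
by apply: (gpd_mulIr (h := f)); rewrite zf [RHS]comp1m.
Qed.

Lemma fraction_act_le z f g :
  fraction_le f g -> fraction_le (fraction_act z f) (fraction_act z g).
Proof. by case: f g => [y f] [w g] [/= c ->]; exists c; rewrite /= compA. Qed.

Definition fraction_shift (f : fraction) : fraction :=
  existT _ (phi S (tag f) : G) (tagged f ;; gen (Delta S (tag f))).

(** The inverse functor provides an inverse image as an arrow; its endpoints then
    have to be identified with the given objects. *)
Lemma phi_full (y z : S) (c : hom (phi S y) (phi S z)) :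
  exists d : hom y z, fmap (phi S) d = c.
Proof.
have obK (u : S) : aut_inv (phi S) (phi S u) = u.
  by have /(congr1 (@src _)) := autK (phi S) (Arrow (idm u)).
have := autVK (phi S) (Arrow c).
rewrite /farrow /=; move: (fmap (aut_inv (phi S)) c).
by rewrite !obK => d /arrow_inj dE; exists d.
Qed.

(** Naturality of [Delta] gives both directions: [f c Delta = f Delta c'] with [c']
    the image of [c] under the automorphism. *)
Lemma fraction_shift_le f g :
  fraction_le (fraction_shift f) (fraction_shift g) <-> fraction_le f g.
Proof.
case: f g => [y f] [z g]; split=> -[/= c].
  have [d <-] := phi_full c.
  rewrite -compA -gen_comp -Delta_natural gen_comp compA => e.
  by exists d; apply: (@gpd_mulIr G _ _ _ _ _ _ e).
move=> ->; exists (fmap (phi S) c); rewrite /= -!compA -!gen_comp.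
by rewrite Delta_natural.
Qed.

Lemma fraction_shift_onto g : exists f, fraction_shift f = g.
Proof.
case: g => [y g].
have yE : phi S (aut_inv (phi S) y) = y.
  by have /(congr1 (@src _)) := autVK (phi S) (Arrow (idm (y : S))).
move: (aut_inv (phi S) y) yE => w wy; case: y / wy g => g.
exists (existT _ (w : G) (g ;; gpd_inv (gen (Delta S w)))).
by rewrite /fraction_shift /= gpd_mulVK.
Qed.

Lemma fraction_shift_act z f :
  fraction_shift (fraction_act z f) = fraction_act z (fraction_shift f).
Proof. by rewrite /fraction_shift /fraction_act /= compA. Qed.

Lemma fraction_le_shift f : fraction_le f (fraction_shift f).
Proof. by exists (Delta S (tag f)). Qed.

(** By induction on the length, a morphism that is not an identity has an atom as a
    left divisor. *)
Lemma simple_divisor (y z : S) (c : hom y z) : ~ is_identity c ->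
  exists (w : S) (s : hom y w) (d : hom w z),
    [/\ c = s ;; d, ~ is_identity s & simple (Delta S) s].
Proof.
have [l [lD l0]] := gcat_homogeneous S.
have [n] := ubnP (l y z c); elim: n z c => // n IH z c lc c_nid.
have [c_atom|c_natom] := EM (atom c).
  by exists z, c, (idm z); rewrite compm1; split=> //; apply: atoms_simple.
have [w [g [h [g_nid h_nid cE]]]] : exists (w : S) (g : hom y w) (h : hom w z),
    [/\ ~ is_identity g, ~ is_identity h & c = g ;; h].
  by apply: contrapT => c_irr; apply: c_natom.
have lg : l y w g < n.
  have h_gt0 : 0 < l w z h by rewrite lt0n; apply/eqP => /l0.
  by move: lc; rewrite cE lD ltnS; apply: leq_trans; rewrite -addn1 leq_add2l.
have [v [s [d [gE s_nid s_simple]]]] := IH w g lg g_nid.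
by exists v, s, (d ;; h); rewrite compA -gE.
Qed.

Lemma fraction_step f g : fraction_le f g -> f <> g ->
  exists h, [/\ fraction_le f h, f <> h, fraction_le h g
               & fraction_le h (fraction_shift f)].
Proof.
case: f g => [y f] [z g] [/= c gE] fg.
have c_nid : ~ is_identity c.
  move: gE fg => -> {g} fg cid; apply: fg; case: {y z c} cid f => y f.
  by rewrite gen_idm compm1.
have [w [s [d [cE s_nid [sbar sE]]]]] := simple_divisor c_nid.
exists (existT _ (w : G) (f ;; gen s)); split.
- by exists s.
- move=> e; apply: s_nid.
  have [/= t tE] : fraction_le (existT _ (w : G) (f ;; gen s)) (existT _ y f).
    by rewrite -e; have [[refl _ _] _ _] := fraction_lattice; apply: refl.
  apply: (identity_of_divisor (d := t)); apply: genS_inj.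
  by apply: (gpd_mulI (f := f)); rewrite gen_comp gen_idm compA -tE compm1.
- by exists d; rewrite /= gE cE gen_comp compA.
- by exists sbar; rewrite /= -sE gen_comp compA.
Qed.

(** The length of an interval [f <= f c] is that of [c], which is determined by the
    interval because the category embeds in its groupoid. *)
Lemma fraction_length : exists len : fraction -> fraction -> nat,
  [/\ forall f g h, fraction_le f g -> fraction_le g h ->
         len f h = len f g + len g h,
      forall f g, fraction_le f g -> len f g = 0 -> f = g &
      forall z f g, len (fraction_act z f) (fraction_act z g) = len f g].
Proof.
have [l [lD l0]] := gcat_homogeneous S.
pose len (f g : fraction) : nat :=
  if pselect (fraction_le f g) is left fg then l _ _ (projT1 (cid fg)) else 0.
have lenE (f g : fraction) (c : @hom S (tag f) (tag g)) :
    tagged g = tagged f ;; gen c -> len f g = l _ _ c.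
  rewrite /len => gE; case: pselect => [fg|[]]; last by exists c.
  case: (cid fg) => /= d dE; congr (l _ _ _); apply: genS_inj.
  by apply: (gpd_mulI (f := tagged f)); rewrite -gE -dE.
exists len; split.
- move=> f g h [c cE] [d dE]; rewrite (lenE _ _ _ cE) (lenE _ _ _ dE) -lD.
  by apply: lenE; rewrite dE cE gen_comp compA.
- move=> f g [c cE]; rewrite (lenE _ _ _ cE) => /l0.
  case: f g c cE => [y f] [z g] /= c -> {g len lenE} cid.
  by case: {y z c} cid f => y f; rewrite gen_idm compm1.
- move=> z f g; have [[c cE]|fg] := EM (fraction_le f g).
    rewrite (lenE _ _ _ cE); apply: (lenE (fraction_act z f) (fraction_act z g) c).
    by rewrite /= cE compA.
  rewrite /len; case: pselect => [[c cE]|_]; last by case: pselect.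
  case: fg; exists c; apply: (gpd_mulI (f := z)); rewrite compA; exact: cE.
Qed.

Definition fraction_action : garside_action (endo x) :=
  GarsideAction fraction_lattice fraction_act1 fraction_actM fraction_free
    fraction_act_le fraction_shift_le fraction_shift_onto fraction_shift_act
    fraction_le_shift fraction_step fraction_length.

End FractionLattice.

(** * Equivariant sequences and centralisers *)

Import Order.TTheory GRing.Theory Num.Theory.

(** An equivalence in the step reaches the negative integers too. *)
Lemma int_succ_ind (P : int -> Prop) :
  P 0%R -> (forall i, P i <-> P (i + 1)%R) -> forall i, P i.
Proof.
move=> P0 PS; elim/int_rect => // n; first by rewrite -addn1 PoszD => /PS.
by move=> Pn; apply/PS; rewrite -addn1 PoszD opprD addrNK.
Qed.

Section MeetTransport.
Variables (T : Type) (leT : T -> T -> Prop).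

(** The relation is arbitrary so that joins, being meets for the converse relation,
   are covered as well. *)
Lemma is_meet_map (h : T -> T) :
  (forall a b, leT (h a) (h b) <-> leT a b) -> (forall b, exists a, h a = b) ->
  forall a b i, is_meet leT a b i -> is_meet leT (h a) (h b) (h i).
Proof.
move=> hE h_onto a b i [ia ib i_max]; split; [exact/hE|exact/hE|].
by move=> u; have [v <-] := h_onto u => /hE va /hE vb; apply/hE/i_max.
Qed.

Lemma is_meet_unique : is_partial_order leT -> forall a b i j,
  is_meet leT a b i -> is_meet leT a b j -> i = j.
Proof.
by move=> [_ anti _] a b i j [ia ib i_max] [ja jb j_max]; apply: anti; auto.
Qed.

End MeetTransport.

Section Sequences.
Variables (Z : groupType) (A : garside_action Z).
Local Notation le := (@ga_le Z A).
Local Notation "z • a" := (@ga_act Z A z a) (at level 35, right associativity).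
Local Notation T := (@ga_shift Z A).
Implicit Types (a b c : A) (i j : int).

Definition shiftz a i : A :=
  match i with Posz n => iter n T a | Negz n => iter n.+1 (@ga_unshift Z A) a end.

Lemma shiftzS a i : shiftz a (i + 1)%R = T (shiftz a i).
Proof.
case: i => [n|[|n]] /=; first by rewrite addn1.
  by rewrite ga_unshiftK.
by rewrite ga_unshiftK subn1.
Qed.

Lemma iter_unshiftK n a : iter n (@ga_unshift Z A) (iter n T a) = a.
Proof. by elim: n a => // n IH a; rewrite iterSr /= ga_shiftK. Qed.

Variables (g : Z) (p : int) (q : nat).
Hypothesis q_gt0 : 0 < q.
Local Open Scope ring_scope.

Definition is_equivariant (a : int -> A) : Prop :=
  [/\ forall i, le (a i) (a (i + 1)),
      forall i, a (i + q%:Z) = T (a i) &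
      forall i, a (i + p) = g • a i].

Definition eseq : Type := {a : int -> A | is_equivariant a}.
Implicit Types (u v w : eseq) (z : centraliser g).

Lemma eseq_eq u v : (forall i, sval u i = sval v i) -> u = v.
Proof. by case: u v => [a ha] [b hb] /= /funext ab; apply: eq_exist. Qed.

Lemma eseq_leS u i : le (sval u i) (sval u (i + 1)).
Proof. by case: (svalP u). Qed.

Lemma eseq_addq u i : sval u (i + q%:Z) = T (sval u i).
Proof. by case: (svalP u). Qed.

Lemma eseq_addp u i : sval u (i + p) = g • sval u i.
Proof. by case: (svalP u). Qed.

Definition eseq_le u v : Prop := forall i, le (sval u i) (sval v i).

Lemma ga_partial_order : is_partial_order le.
Proof. by case: (ga_lattice A). Qed.

Lemma act_onto (z : Z) b : exists a, z • a = b.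
Proof. by exists (z^-1%g • b); rewrite actVK. Qed.

(** Both [T] and [g] are automorphisms of the lattice, hence commute with meets. *)
Lemma meet_equivariant u v (m : int -> A) :
  (forall i, is_meet le (sval u i) (sval v i) (m i)) -> is_equivariant m.
Proof.
move=> mP; split=> i.
- have [_ _] := mP (i + 1); have [mu mv _] := mP i.
  by apply; [apply: ga_trans mu _|apply: ga_trans mv _]; apply: eseq_leS.
- apply: (is_meet_unique ga_partial_order (mP _)); rewrite !eseq_addq.
  exact: (is_meet_map (@ga_shift_le _ A) (@ga_shift_onto _ A)).
- apply: (is_meet_unique ga_partial_order (mP _)); rewrite !eseq_addp.
  exact: (is_meet_map (@act_leE _ A g) (@act_onto g)).
Qed.

Lemma join_equivariant u v (m : int -> A) :
  (forall i, is_join le (sval u i) (sval v i) (m i)) -> is_equivariant m.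
Proof.
have dual : is_partial_order (fun a b => le b a).
  have [refl anti trans] := ga_partial_order.
  by split=> // [a b ab ba|a b c ba cb]; [exact: anti|exact: trans cb ba].
move=> mP; split=> i.
- have [um vm _] := mP (i + 1); have [_ _] := mP i.
  by apply; [apply: ga_trans _ um|apply: ga_trans _ vm]; apply: eseq_leS.
- apply: (is_meet_unique dual (mP _)); rewrite !eseq_addq.
  by apply: (is_meet_map (leT := fun a b => le b a) _ (@ga_shift_onto _ A)
    (mP i)) => a b; apply: ga_shift_le.
- apply: (is_meet_unique dual (mP _)); rewrite !eseq_addp.
  by apply: (is_meet_map (leT := fun a b => le b a) _ (@act_onto g)
    (mP i)) => a b; apply: act_leE.
Qed.

Lemma eseq_meet u v :
  exists w : eseq, forall i, is_meet le (sval u i) (sval v i) (sval w i).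
Proof.
have [_ _ meets] := ga_lattice A.
have [m mP] := choice (fun i => meets (sval u i) (sval v i)).
by exists (exist _ m (meet_equivariant mP)).
Qed.

Lemma eseq_lattice : is_lattice eseq_le.
Proof.
split.
- split=> [u i|u v uv vu|u v w uv vw i]; first exact: ga_refl.
    by apply: eseq_eq => i; apply: ga_anti.
  exact: ga_trans (uv i) (vw i).
- move=> u v; have [_ joins _] := ga_lattice A.
  have [m mP] := choice (fun i => joins (sval u i) (sval v i)).
  exists (exist _ m (join_equivariant mP)).
  split=> [i|i|w uw vw i] /=; have [um vm mw] := mP i => //.
  by apply: mw.
- move=> u v; have [w wP] := eseq_meet u v.
  exists w; split=> [i|i|z zu zv i]; have [wu wv w_max] := wP i => //.
  by apply: w_max.
Qed.

Lemma shift_equivariant u : is_equivariant (fun i => sval u (i + 1)).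
Proof.
split=> i; first exact: eseq_leS.
  by rewrite addrAC eseq_addq.
by rewrite addrAC eseq_addp.
Qed.

Lemma unshift_equivariant u : is_equivariant (fun i => sval u (i - 1)).
Proof.
split=> i; first by rewrite addrAC; apply: eseq_leS.
  by rewrite addrAC eseq_addq.
by rewrite addrAC eseq_addp.
Qed.

Definition eseq_next u : eseq := exist _ _ (shift_equivariant u).

Lemma eseq_next_le u v : eseq_le (eseq_next u) (eseq_next v) <-> eseq_le u v.
Proof.
split=> uv i; last exact: uv.
by have := uv (i - 1); rewrite /= subrK.
Qed.

Lemma eseq_next_onto v : exists u, eseq_next u = v.
Proof.
by exists (exist _ _ (unshift_equivariant v)); apply: eseq_eq => i /=; rewrite addrK.
Qed.

Lemma le_eseq_next u : eseq_le u (eseq_next u).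
Proof. by move=> i; apply: eseq_leS. Qed.

(** The meet of [v] with the shifted [u] serves. If it were [u], then by induction
    [v i] and [u (i + n)] would have meet [u i] for all [n]; with [n = q], this
    contradicts the same property of the lattice, as [u (i + q) = T (u i)]. *)
Lemma eseq_step u v : eseq_le u v -> u <> v ->
  exists w, [/\ eseq_le u w, u <> w, eseq_le w v & eseq_le w (eseq_next u)].
Proof.
move=> uv u_neq_v; have [w wP] := eseq_meet v (eseq_next u).
exists w; split=> [i|uw|i|i]; try by case: (wP i).
  by have [_ _] := wP i; apply; [apply: uv|apply: eseq_leS].
have below n : forall i b, le b (sval v i) -> le b (sval u (i + n%:Z)) -> le b (sval u i).
  elim: n => [|n IH] i b bv; first by rewrite addr0.
  rewrite -add1n PoszD addrA => bu; rewrite uw; have [_ _] := wP i; apply=> //.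
  exact: IH (ga_trans bv (eseq_leS v i)) bu.
have [i ui_neq_vi] : exists i, sval u i <> sval v i.
  apply: contrapT => all_eq; apply: u_neq_v; apply: eseq_eq => i.
  by apply: contrapT => neq; apply: all_eq; exists i.
have [b [ub u_neq_b bv bT]] := ga_step (uv i) ui_neq_vi.
by apply: u_neq_b; apply: ga_anti ub _; apply: (below q) => //; rewrite eseq_addq.
Qed.

Lemma eseq_eq_period u v :
  (forall k, (k < q)%N -> sval u k%:Z = sval v k%:Z) -> u = v.
Proof.
move=> uv; apply: eseq_eq => i; rewrite (divz_eq i q%:Z) addrC.
have q0 : q%:Z != 0 by rewrite -lt0n.
have [k kE] : exists k : nat, (i %% q)%Z = k%:Z.
  by exists `|(i %% q)%Z|%N; rewrite gez0_abs // modz_ge0.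
have kq : (k < q)%N by have := ltz_mod i q0; rewrite kE ltz_nat.
rewrite {}kE; elim/int_succ_ind: (i %/ q)%Z => [|j]; first by rewrite mul0r addr0 uv.
rewrite mulrDl mul1r addrA !eseq_addq; split=> [-> //|]; exact: ga_shift_inj.
Qed.

Lemma centralisesP (z : centraliser g) : (g * val z = val z * g)%g.
Proof. by apply/eqP; apply: (valP z). Qed.

Lemma act_equivariant (z : centraliser g) u : is_equivariant (fun i => val z • sval u i).
Proof.
split=> i; first exact/ga_act_le/eseq_leS.
  by rewrite eseq_addq ga_shift_act.
by rewrite eseq_addp -!ga_actM centralisesP.
Qed.

Definition eseq_act (z : centraliser g) u : eseq := exist _ _ (act_equivariant z u).

(** A sequence is determined by one period, so that the sum over a period of the
    lengths vanishes for equal sequences only. *)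
Lemma eseq_length : exists len : eseq -> eseq -> nat,
  [/\ forall u v w, eseq_le u v -> eseq_le v w -> len u w = (len u v + len v w)%N,
      forall u v, eseq_le u v -> len u v = 0%N -> u = v &
      forall z u v, len (eseq_act z u) (eseq_act z v) = len u v].
Proof.
have [len [lenD len0 len_act]] := ga_length A.
exists (fun u v => (\sum_(k < q) len (sval u k%:Z) (sval v k%:Z))%N); split.
- move=> u v w uv vw; rewrite -big_split; apply: eq_bigr => k _ /=.
  exact: lenD (uv _) (vw _).
- move=> u v uv /eqP; rewrite sum_nat_eq0 => /forallP len_eq0.
  apply: eseq_eq_period => k kq; apply: len0 => //.
  exact/eqP/(len_eq0 (Ordinal kq)).
- by move=> z u v; apply: eq_bigr => k _; apply: len_act.
Qed.

Lemma eseq_act1 u : eseq_act 1%g u = u.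
Proof. by apply: eseq_eq => i; apply: ga_act1. Qed.

Lemma eseq_actM (z w : centraliser g) u :
  eseq_act (z * w)%g u = eseq_act z (eseq_act w u).
Proof. by apply: eseq_eq => i; apply: ga_actM. Qed.

Lemma eseq_free z u : eseq_act z u = u -> z = 1%g.
Proof.
by move=> /(congr1 (fun w => sval w 0)) /= /ga_free z1; apply: val_inj.
Qed.

Lemma eseq_act_le z u v :
  eseq_le u v -> eseq_le (eseq_act z u) (eseq_act z v).
Proof. by move=> uv i; apply/ga_act_le/uv. Qed.

Lemma eseq_next_act z u :
  eseq_next (eseq_act z u) = eseq_act z (eseq_next u).
Proof. exact: eseq_eq. Qed.

Definition centraliser_action : garside_action (centraliser g) :=
  GarsideAction eseq_lattice eseq_act1 eseq_actM eseq_free eseq_act_le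
    eseq_next_le eseq_next_onto eseq_next_act le_eseq_next eseq_step eseq_length.

Variable a0 : A.
Hypothesis a0P : (g ^+ q)%g • a0 = shiftz a0 p.

(** The hypothesis at [a0] spreads along the whole [T]-orbit of [a0], because [g]
    commutes with [T]. *)
Lemma shiftz_periodic i : (g ^+ q)%g • shiftz a0 i = shiftz a0 (i + p).
Proof.
elim/int_succ_ind: i => [|i]; first by rewrite add0r.
rewrite shiftzS addrAC shiftzS -ga_shift_act.
by split=> [-> //|]; exact: ga_shift_inj.
Qed.

Lemma shiftz_le i j : i <= j -> le (shiftz a0 i) (shiftz a0 j).
Proof.
rewrite -subr_ge0 => ij; rewrite -(subrKC i j) -(gez0_abs ij).
move: (absz _) => {ij} n.
elim: n => [|n IH]; first by rewrite addr0; apply: ga_refl.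
rewrite -addn1 PoszD addrA shiftzS; exact: ga_trans IH (ga_le_shift _).
Qed.

(** An equivariant sequence with value [a0] at [0] has value [g ^ k (T ^ v a0)] at
    [k p + v q]. Its value at [i] is above those with [k p + v q <= i]; for a
    given [k], the largest such [v] is taken. *)
Definition translate i k : A := (g ^+ k)%g • shiftz a0 ((i - k%:Z * p) %/ q%:Z)%Z.

Definition is_sup (F : nat -> A) (s : A) : Prop :=
  (forall k, le (F k) s) /\ (forall b, (forall k, le (F k) b) -> le s b).

Lemma is_sup_unique F s s' : is_sup F s -> is_sup F s' -> s = s'.
Proof. by move=> [s1 s2] [s1' s2']; apply: ga_anti; [apply: s2|apply: s2']. Qed.

Lemma periodic_sup F : (forall k, F (k + q)%N = F k) -> exists s, is_sup F s.
Proof.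
move=> Fq.
have [s [sF s_min]] : exists s, (forall k, (k < q)%N -> le (F k) s) /\
    (forall b, (forall k, (k < q)%N -> le (F k) b) -> le s b).
  case: q q_gt0 => // n _ {Fq}; elim: n => [|n [s [sF s_min]]].
    exists (F 0%N); split=> [[|//] _|b]; first exact: ga_refl.
    exact.
  have [_ joins _] := ga_lattice A; have [t [st Ft t_min]] := joins s (F n.+1).
  exists t; split=> [k|b Fb].
    by rewrite ltnS leq_eqVlt => /orP[/eqP-> //|kn]; apply: ga_trans (sF _ kn) st.
  by apply: t_min; [apply: s_min => k kn; apply: Fb; apply: ltnW|apply: Fb].
exists s; split=> [k|b Fb]; last by apply: s_min => k _; apply: Fb.
rewrite (divn_eq k q); elim: (k %/ q)%N => [|m IH].
  by rewrite mul0n add0n; apply: sF; rewrite ltn_mod.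
by rewrite mulSn -addnA addnC Fq.
Qed.

Let q_neq0 : q%:Z != 0. Proof. by rewrite -lt0n. Qed.

Lemma translate_period i k : translate i (k + q)%N = translate i k.
Proof.
rewrite /translate expgnDr ga_actM shiftz_periodic; congr (_ • shiftz _ _).
have -> : i - (k + q)%N%:Z * p = - p * q%:Z + (i - k%:Z * p).
  by rewrite PoszD mulrDl opprD mulNr [q%:Z * p]mulrC addrA addrC.
by rewrite divzMDl // addrAC addNr add0r.
Qed.

Lemma translate_shift i k : translate (i + q%:Z) k = T (translate i k).
Proof.
rewrite /translate ga_shift_act -shiftzS; congr (_ • shiftz _ _).
by rewrite addrAC addrC -{1}[q%:Z]mul1r divzMDl // [LHS]addrC.
Qed.

Lemma translate_act i k : translate (i + p) k.+1 = g • translate i k.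
Proof.
rewrite /translate expgS ga_actM; congr (_ • _ • shiftz _ (_ %/ _)%Z).
by rewrite -addn1 PoszD mulrDl mul1r opprD addrA addrAC addrK.
Qed.

Lemma translate_le i k : le (translate i k) (translate (i + 1) k).
Proof.
apply/ga_act_le/shiftz_le/lez_pdiv2r => //.
by rewrite lerD2r lerDl.
Qed.

(** The joins of the [translate i k] over all [k] form an equivariant sequence.
    [T] and [g] take the family of [i] to those of [i + q] and [i + p]; under [g]
    its image starts at [k = 1] instead of [k = 0], which does not matter as the
    family is periodic in [k]. *)
Lemma eseq_inhabited : exists u : eseq, True.
Proof.
have [a aP] := choice (fun i => periodic_sup (translate_period i)).
suff ha : is_equivariant a by exists (exist _ a ha).
split=> i.
- have [ub _] := aP (i + 1); have [_] := aP i; apply=> k.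
  exact: ga_trans (translate_le i k) (ub k).
- apply: (is_sup_unique (aP _)); have [ub lub] := aP i; split=> [k|b].
    by rewrite translate_shift; apply/ga_shift_le.
  have [c <-] := ga_shift_onto b => cb; apply/ga_shift_le/lub => k.
  by apply/ga_shift_le; rewrite -translate_shift.
- apply: (is_sup_unique (aP _)); have [ub lub] := aP i; split=> [k|b cb].
    rewrite -translate_period -(prednK q_gt0) addnS translate_act.
    exact/ga_act_le.
  rewrite -(actVK g b); apply/ga_act_le/lub => k.
  by rewrite -(act_leE g) actVK -translate_act.
Qed.

End Sequences.

Theorem corollary0p6 (S : garside_structure) (S_cyclic : cyclic S)
    (x : garside_groupoid S) (gamma : endo x) (gamma_periodic : periodic gamma) :
  weak_garside_group (centraliser gamma).
Proof.
case: gamma_periodic => p [q [q_gt0 gammaE]].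
pose A := fraction_action x.
pose T y := @fraction_shift S y.
pose a0 : A := existT _ (x : garside_groupoid S) (idm x).
have iterT (y z : garside_groupoid S) (f : hom y z) n :
    iter n (T y) (existT _ z f) = existT _ (iter n (phi S) z) (f ;; gen (Delta_nat n z)).
  elim: n => [|n IH]; first by rewrite -[Delta_nat 0 z]/(idm (z : S)) gen_idm compm1.
  rewrite iterS IH; congr (existT _ _ _).
  by rewrite -[Delta_nat n.+1 z]/(Delta_nat n z ;; _) gen_comp compA.
suff a0P : @ga_act _ A (gamma ^+ q)%g a0 = shiftz a0 p.
  have [u _] := eseq_inhabited q_gt0 a0P.
  exact: weak_garside_of_action (centraliser_action A gamma p q_gt0) u.
pose b : A := existT (fun y => hom x y) x (gamma ^+ q)%g.
have -> : @ga_act _ A (gamma ^+ q)%g a0 = b.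
  by congr (existT _ _ _); apply: compm1.
case: p gammaE => [n|m] gammaE.
  (* Both properties [P] are stated for an arbitrary arrow so as to be transported
     along [gammaE], an equality of arrows with different formal endpoints. *)
  pose P (a : arrow (garside_groupoid S)) :=
    existT _ (tgt a) (mor a) = iter n (T (src a)) (existT _ (src a) (idm (src a))).
  have : P (Delta_pow n x) by rewrite /P /= iterT comp1m.
  by rewrite -gammaE.
pose P (a : arrow (garside_groupoid S)) :=
  iter m.+1 (T (src a)) (existT _ (tgt a) (mor a)) = existT _ (src a) (idm (src a)).
have : P (Delta_pow (Negz m) x).
  by rewrite /P iterT; congr (existT _ _ _); apply: gpd_mulVm.
by rewrite -gammaE /P => E; rewrite -(iter_unshiftK m.+1 b); congr (iter _ _ _).
Qed.
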